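(* For every $\mathcal L_{\forall\exists}$-formula $\chi$, $$\mathsf{MS4.t}\vdash\chi^\flat\leftrightarrow\chi^{t\#}.$$ Consequently, the translation $(-)^\flat$ of $\mathsf{MIPC}$ into $\mathsf{MS4.t}$ is full and faithful; that is, for every $\mathcal L_{\forall\exists}$-formula $\chi$, $\mathsf{MIPC}\vdash\chi$ iff $\mathsf{MS4.t}\vdash\chi^\flat$.
   Context: **MIPC.** $\mathcal L_{\forall\exists}$ is the propositional language with connectives $\bot,\wedge,\vee,\to$ (with $\neg\varphi:=\varphi\to\bot$) and two unary modalities $\forall,\exists$. The monadic intuitionistic propositional calculus $\mathsf{MIPC}$ is the least intuitionistic modal logic in $\mathcal L_{\forall\exists}$ containing all theorems of the intuitionistic propositional calculus; the axioms $\forall(p\wedge q)\leftrightarrow(\forall p\wedge\forall q)$, $\forall p\to p$, $\forall p\to\forall\forall p$; the axioms $\exists(p\vee q)\leftrightarrow(\exists p\vee\exists q)$, $p\to\exists p$, $\exists\exists p\to\exists p$, $(\exists p\wedge\exists q)\to\exists(\exists p\wedge q)$; the axioms $\exists\forall p\leftrightarrow\forall p$, $\exists p\leftrightarrow\forall\exists p$; and closed under modus ponens, substitution, necessitation ($\varphi/\forall\varphi$), and replacement of provable equivalents (from $\varphi\leftrightarrow\psi$ infer $\forall\varphi\leftrightarrow\forall\psi$ and $\exists\varphi\leftrightarrow\exists\psi$). **MS4.t.** $\mathcal L_{T\forall}$ is the classical propositional language with unary modalities $\Box_F,\Box_P,\forall$; $\Diamond_F:=\neg\Box_F\neg$, $\Diamond_P:=\neg\Box_P\neg$,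 $\exists:=\neg\forall\neg$. $\mathsf{MS4.t}$ is the least set of $\mathcal L_{T\forall}$-formulas containing all classical tautologies; the $\mathsf{S4}$-axioms $\blacksquare(p\to q)\to(\blacksquare p\to\blacksquare q)$, $\blacksquare p\to p$, $\blacksquare p\to\blacksquare\blacksquare p$ for each $\blacksquare\in\{\Box_F,\Box_P\}$; the tense axioms $p\to\Box_P\Diamond_F p$ and $p\to\Box_F\Diamond_P p$; the $\mathsf{S5}$-axioms for $\forall$ (the $\mathsf{S4}$-axioms for $\forall$ together with $p\to\forall\exists p$); the axiom $\Box_F\forall p\to\forall\Box_F p$; and closed under modus ponens, substitution, and necessitation for $\Box_F,\Box_P,\forall$. **Translations** (from $\mathcal L_{\forall\exists}$ to $\mathcal L_{T\forall}$). $(-)^{t\#}$ is the composition of the Gödel translation $(-)^t$ of $\mathsf{MIPC}$ into $\mathsf{MS4}$ with the replacement $(-)^\#$ of $\Box$ by $\Box_F$; explicitly: $\bot^{t\#}=\bot$; $p^{t\#}=\Box_F p$ for propositional letters $p$; $(\varphi\wedge\psi)^{t\#}=\varphi^{t\#}\wedge\psi^{t\#}$; $(\varphi\vee\psi)^{t\#}=\varphi^{t\#}\vee\psi^{t\#}$; $(\varphi\to\psi)^{t\#}=\Box_F(\neg\varphi^{t\#}\vee\psi^{t\#})$; $(\forall\varphi)^{t\#}=\Box_F\forall\varphi^{t\#}$; $(\exists\varphi)^{t\#}=\exists\varphi^{t\#}$. The translation $(-)^\flat$ has the same clauses (with $\flat$ in place of $t\#$) except that $(\exists\varphi)^\flat=\Diamond_P\exists\varphi^\flat$.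 *)

(* Defs.v *)
From Stdlib Require Import Bool.

Inductive iform : Type :=
| IVar (n : nat)
| IBot
| IAnd (A B : iform)
| IOr (A B : iform)
| IImp (A B : iform)
| IAll (A : iform)
| IEx (A : iform).

Definition IIff (A B : iform) : iform := IAnd (IImp A B) (IImp B A).

Declare Scope iform_scope.
Delimit Scope iform_scope with iform.
Bind Scope iform_scope with iform.
Infix "&&" := IAnd : iform_scope.
Infix "||" := IOr : iform_scope.
Notation "A --> B" := (IImp A B) (at level 55, right associativity) : iform_scope.
Notation "A <--> B" := (IIff A B) (at level 57, no associativity) : iform_scope.

Fixpoint isubst (s : nat -> iform) (A : iform) : iform :=
  match A with
  | IVar n => s n
  | IBot => IBot
  | IAnd A B => IAnd (isubst s A) (isubst s B)
  | IOr A B => IOr (isubst s A) (isubst s B)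
  | IImp A B => IImp (isubst s A) (isubst s B)
  | IAll A => IAll (isubst s A)
  | IEx A => IEx (isubst s A)
  end.

(** Since the axioms are schemata over all of [iform], this is the set of
    substitution instances of IPC-theorems; [MIPC] is closed under substitution
    anyway. *)
Inductive IPC : iform -> Prop :=
| ipc_k A B : IPC (A --> B --> A)
| ipc_s A B C : IPC ((A --> B --> C) --> (A --> B) --> A --> C)
| ipc_and_l A B : IPC (A && B --> A)
| ipc_and_r A B : IPC (A && B --> B)
| ipc_and_i A B : IPC (A --> B --> A && B)
| ipc_or_l A B : IPC (A --> A || B)
| ipc_or_r A B : IPC (B --> A || B)
| ipc_or_e A B C : IPC ((A --> C) --> (B --> C) --> A || B --> C)
| ipc_bot A : IPC (IBot --> A)
| ipc_mp A B : IPC (A --> B) -> IPC A -> IPC B.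

Section MIPC.
Local Notation p := (IVar 0).
Local Notation q := (IVar 1).

Inductive MIPC : iform -> Prop :=
| mipc_ipc A : IPC A -> MIPC A
| mipc_all_and : MIPC (IAll (p && q) <--> (IAll p && IAll q))
| mipc_all_t : MIPC (IAll p --> p)
| mipc_all_4 : MIPC (IAll p --> IAll (IAll p))
| mipc_ex_or : MIPC (IEx (p || q) <--> (IEx p || IEx q))
| mipc_ex_t : MIPC (p --> IEx p)
| mipc_ex_4 : MIPC (IEx (IEx p) --> IEx p)
| mipc_ex_and : MIPC ((IEx p && IEx q) --> IEx (IEx p && q))
| mipc_ex_all : MIPC (IEx (IAll p) <--> IAll p)
| mipc_all_ex : MIPC (IEx p <--> IAll (IEx p))
| mipc_mp A B : MIPC (A --> B) -> MIPC A -> MIPC B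
| mipc_subst s A : MIPC A -> MIPC (isubst s A)
| mipc_nec A : MIPC A -> MIPC (IAll A)
| mipc_re_all A B : MIPC (A <--> B) -> MIPC (IAll A <--> IAll B)
| mipc_re_ex A B : MIPC (A <--> B) -> MIPC (IEx A <--> IEx B).

End MIPC.

Inductive modality : Type := Future | Past | Quant.

Inductive tform : Type :=
| TVar (n : nat)
| TBot
| TAnd (A B : tform)
| TOr (A B : tform)
| TImp (A B : tform)
| TBox (m : modality) (A : tform).

Definition TNeg (A : tform) : tform := TImp A TBot.
Definition TIff (A B : tform) : tform := TAnd (TImp A B) (TImp B A).
Definition TDia (m : modality) (A : tform) : tform := TNeg (TBox m (TNeg A)).

Notation BoxF := (TBox Future).
Notation BoxP := (TBox Past).
Notation TAll := (TBox Quant).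
Notation DiaF := (TDia Future).
Notation DiaP := (TDia Past).
Notation TEx := (TDia Quant).

Declare Scope tform_scope.
Delimit Scope tform_scope with tform.
Bind Scope tform_scope with tform.
Infix "&&" := TAnd : tform_scope.
Infix "||" := TOr : tform_scope.
Notation "A --> B" := (TImp A B) (at level 55, right associativity) : tform_scope.
Notation "A <--> B" := (TIff A B) (at level 57, no associativity) : tform_scope.

Fixpoint tsubst (s : nat -> tform) (A : tform) : tform :=
  match A with
  | TVar n => s n
  | TBot => TBot
  | TAnd A B => TAnd (tsubst s A) (tsubst s B)
  | TOr A B => TOr (tsubst s A) (tsubst s B)
  | TImp A B => TImp (tsubst s A) (tsubst s B)
  | TBox m A => TBox m (tsubst s A)
  end.

(** Truth-table evaluation; letters and boxed formulas are the atoms, with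
    truth values given by [v]. *)
Fixpoint truth (v : tform -> bool) (A : tform) : bool :=
  match A with
  | TVar _ | TBox _ _ => v A
  | TBot => false
  | TAnd A B => andb (truth v A) (truth v B)
  | TOr A B => orb (truth v A) (truth v B)
  | TImp A B => implb (truth v A) (truth v B)
  end.

Definition tautology (A : tform) : Prop :=
  forall v : tform -> bool, truth v A = true.

Section MS4t.
Local Notation p := (TVar 0).
Local Notation q := (TVar 1).

Inductive MS4t : tform -> Prop :=
| ms4t_taut A : tautology A -> MS4t A
| ms4t_k m : MS4t (TBox m (p --> q) --> (TBox m p --> TBox m q))
| ms4t_t m : MS4t (TBox m p --> p)
| ms4t_4 m : MS4t (TBox m p --> TBox m (TBox m p))
| ms4t_PF : MS4t (p --> BoxP (DiaF p))
| ms4t_FP : MS4t (p --> BoxF (DiaP p))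
| ms4t_b : MS4t (p --> TAll (TEx p))
| ms4t_comm : MS4t (BoxF (TAll p) --> TAll (BoxF p))
| ms4t_mp A B : MS4t (A --> B) -> MS4t A -> MS4t B
| ms4t_subst s A : MS4t A -> MS4t (tsubst s A)
| ms4t_nec m A : MS4t A -> MS4t (TBox m A).

End MS4t.

Fixpoint tsharp (A : iform) : tform :=
  match A with
  | IVar n => BoxF (TVar n)
  | IBot => TBot
  | IAnd A B => tsharp A && tsharp B
  | IOr A B => tsharp A || tsharp B
  | IImp A B => BoxF (TNeg (tsharp A) || tsharp B)
  | IAll A => BoxF (TAll (tsharp A))
  | IEx A => TEx (tsharp A)
  end.

Fixpoint flat (A : iform) : tform :=
  match A with
  | IVar n => BoxF (TVar n)
  | IBot => TBot
  | IAnd A B => flat A && flat B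
  | IOr A B => flat A || flat B
  | IImp A B => BoxF (TNeg (flat A) || flat B)
  | IAll A => BoxF (TAll (flat A))
  | IEx A => DiaP (TEx (flat A))
  end.

(* Main.v *)
Require Import Defs.
From Stdlib Require Import Arith Cantor Classical ClassicalEpsilon.

(** The two translations differ only at [IEx], where [flat] has an extra
    [DiaP].  Every translated formula [tsharp A] is persistent, that is, MS4.t
    proves [tsharp A --> BoxF (tsharp A)] ([tsharp_persistent]); at [IEx] this
    follows from the axiom relating [BoxF] and [TAll].  On persistent formulas
    [DiaP] is vacuous, since [DiaP (BoxF A)] implies [A] by the tense axioms.
    Hence [flat A] and [tsharp A] are equivalent ([flat_tsharp_iff]), and it
    remains to show that [tsharp] is full and faithful.

    That [tsharp] preserves theorems ([MIPC_tsharp]) is a syntactic induction on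
    MIPC-derivations, in which persistence supplies the deduction rule for the
    translated implication.

    For the converse ([tsharp_MIPC]), a Kripke structure for MS4 is also one for
    MS4.t, once the past modality is read along the converse of the relation for
    the future ([MS4t_sound]).  The canonical structure of MIPC is of this kind:
    its worlds are the prime theories, the future relation is inclusion, and the
    quantifier relation holds between prime theories with the same static
    formulas, those [C] for which MIPC proves [IEx C --> C].  In it, [tsharp A]
    holds exactly at the prime theories containing [A] ([holds_tsharp]), so a
    non-theorem [A] of MIPC is refuted, [tsharp A] failing at a prime theory
    that omits [A].  The worlds needed for the frame condition and for the truth
    lemma at [IEx] and [IAll] all come from one separation argument
    ([prime_extension]): a theory [x] extends to a prime theory with the same
    static formulas as the prime theory [z], as soon as [IEx A] is in [z] for
    every [A] in [x]. *)

(** * Derived rules of MS4.t *)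

Local Open Scope tform_scope.

(** Proves [MS4t A] when [A] is a propositional tautology in which boxed
    formulas, and subformulas of unknown shape such as [tsharp B] for a
    variable [B], count as atoms. *)
Ltac ms4t_tautology :=
  apply ms4t_taut; unfold TIff, TDia, TNeg;
  let v := fresh "v" in
  intro v; cbn;
  repeat match goal with
         | |- context [truth v ?X] => destruct (truth v X)
         | |- context [v ?X] => destruct (v X)
         end; reflexivity.

(** Proves [MS4t A] when [A] is a tautological consequence of the formulas
    whose derivations are given. *)
Tactic Notation "taut_from" constr(H1) :=
  refine (ms4t_mp _ _ _ H1); ms4t_tautology.
Tactic Notation "taut_from" constr(H1) constr(H2) :=
  refine (ms4t_mp _ _ (ms4t_mp _ _ _ H1) H2); ms4t_tautology.
Tactic Notation "taut_from" constr(H1) constr(H2) constr(H3) :=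
  refine (ms4t_mp _ _ (ms4t_mp _ _ (ms4t_mp _ _ _ H1) H2) H3); ms4t_tautology.

Definition tsubst2 (A B : tform) (n : nat) : tform :=
  match n with 0 => A | _ => B end.

Lemma box_imp m A B : MS4t (TBox m (A --> B) --> TBox m A --> TBox m B).
Proof. exact (ms4t_subst (tsubst2 A B) _ (ms4t_k m)). Qed.

Lemma box_elim m A : MS4t (TBox m A --> A).
Proof. exact (ms4t_subst (tsubst2 A A) _ (ms4t_t m)). Qed.

Lemma box_box m A : MS4t (TBox m A --> TBox m (TBox m A)).
Proof. exact (ms4t_subst (tsubst2 A A) _ (ms4t_4 m)). Qed.

Lemma boxP_diaF A : MS4t (A --> BoxP (DiaF A)).
Proof. exact (ms4t_subst (tsubst2 A A) _ ms4t_PF). Qed.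

Lemma all_ex A : MS4t (A --> TAll (TEx A)).
Proof. exact (ms4t_subst (tsubst2 A A) _ ms4t_b). Qed.

Lemma boxF_all A : MS4t (BoxF (TAll A) --> TAll (BoxF A)).
Proof. exact (ms4t_subst (tsubst2 A A) _ ms4t_comm). Qed.

Lemma t_trans B A C : MS4t (A --> B) -> MS4t (B --> C) -> MS4t (A --> C).
Proof. intros H1 H2. taut_from H1 H2. Qed.

Lemma box_mono m A B : MS4t (A --> B) -> MS4t (TBox m A --> TBox m B).
Proof. intro H. exact (ms4t_mp _ _ (box_imp m A B) (ms4t_nec m _ H)). Qed.

Lemma box_mono2 m A B C :
  MS4t (A --> B --> C) -> MS4t (TBox m A --> TBox m B --> TBox m C).
Proof.
  intro H. pose proof (box_mono m _ _ H) as H1.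
  taut_from H1 (box_imp m B C).
Qed.

Lemma dia_mono m A B : MS4t (A --> B) -> MS4t (TDia m A --> TDia m B).
Proof.
  intro H. assert (H1 : MS4t (TNeg B --> TNeg A)) by taut_from H.
  taut_from (box_mono m _ _ H1).
Qed.

Lemma dia_intro m A : MS4t (A --> TDia m A).
Proof. taut_from (box_elim m (TNeg A)). Qed.

Lemma dia_dia m A : MS4t (TDia m (TDia m A) --> TDia m A).
Proof.
  assert (H : MS4t (TBox m (TNeg A) --> TNeg (TDia m A))) by ms4t_tautology.
  pose proof (box_mono m _ _ H) as H1.
  taut_from H1 (box_box m (TNeg A)).
Qed.

Lemma dia_or m A B : MS4t (TDia m (A || B) --> TDia m A || TDia m B).
Proof.
  assert (H : MS4t (TNeg A --> TNeg B --> TNeg (A || B))) by ms4t_tautology.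
  taut_from (box_mono2 m _ _ _ H).
Qed.

Lemma box_dia_and m A B : MS4t (TBox m A --> TDia m B --> TDia m (A && B)).
Proof.
  assert (H : MS4t (A --> TNeg (A && B) --> TNeg B)) by ms4t_tautology.
  taut_from (box_mono2 m _ _ _ H).
Qed.

(** Contraposition turns the unit of the adjunction between [TDia m'] and
    [TBox m] into the counit of that between [TDia m] and [TBox m'].  This
    covers the first tense axiom and the symmetry axiom for [TAll]. *)
Lemma dia_box_elim m m' :
  (forall A, MS4t (A --> TBox m (TDia m' A))) ->
  forall A, MS4t (TDia m (TBox m' A) --> A).
Proof.
  intros H A.
  assert (H0 : MS4t (A --> TNeg (TNeg A))) by ms4t_tautology.
  pose proof (box_mono m' _ _ H0) as H1.
  assert (H2 : MS4t (TDia m' (TNeg A) --> TNeg (TBox m' A))) by taut_from H1.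
  pose proof (box_mono m _ _ H2) as H3.
  taut_from H3 (H (TNeg A)).
Qed.

Lemma diaP_boxF A : MS4t (DiaP (BoxF A) --> A).
Proof. exact (dia_box_elim _ _ boxP_diaF A). Qed.

Lemma ex_all A : MS4t (TEx (TAll A) --> TAll A).
Proof.
  exact (t_trans _ _ _ (dia_mono _ _ _ (box_box _ _))
           (dia_box_elim _ _ all_ex _)).
Qed.

Lemma ex_all_ex A : MS4t (TEx A --> TAll (TEx A)).
Proof.
  exact (t_trans _ _ _ (all_ex _) (box_mono _ _ _ (dia_dia _ _))).
Qed.

Lemma ex_boxF A : MS4t (TEx (BoxF A) --> BoxF (TEx A)).
Proof.
  (* [BoxF (TEx A)] is fixed by [TEx], because [TEx A] is fixed by [TAll]. *)
  assert (H : MS4t (BoxF (TEx A) --> TAll (BoxF (TEx A)))).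
  { exact (t_trans _ _ _ (box_mono _ _ _ (ex_all_ex A)) (boxF_all _)). }
  pose proof (dia_mono Quant _ _
                (box_mono Future _ _ (dia_intro Quant A))) as H1.
  pose proof (dia_mono Quant _ _ H) as H2.
  pose proof (t_trans _ _ _ H2 (dia_box_elim _ _ all_ex _)) as H3.
  exact (t_trans _ _ _ H1 H3).
Qed.

(** * The two translations agree *)

(** The Gödel translation of every formula is persistent along the future
    relation. *)
Lemma tsharp_persistent A : MS4t (tsharp A --> BoxF (tsharp A)).
Proof.
  induction A as [n| |A IHA B IHB|A IHA B IHB|A IHA B IHB|A IHA|A IHA]; cbn.
  - apply box_box.
  - ms4t_tautology.
  - assert (H : MS4t (tsharp A --> tsharp B --> tsharp A && tsharp B))
      by ms4t_tautology.
    taut_from (box_mono2 Future _ _ _ H) IHA IHB.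
  - assert (HA : MS4t (tsharp A --> tsharp A || tsharp B)) by ms4t_tautology.
    assert (HB : MS4t (tsharp B --> tsharp A || tsharp B)) by ms4t_tautology.
    pose proof (t_trans _ _ _ IHA (box_mono Future _ _ HA)) as H1.
    pose proof (t_trans _ _ _ IHB (box_mono Future _ _ HB)) as H2.
    taut_from H1 H2.
  - apply box_box.
  - apply box_box.
  - exact (t_trans _ _ _ (dia_mono _ _ _ IHA) (ex_boxF _)).
Qed.

Lemma flat_tsharp_iff chi : MS4t (flat chi <--> tsharp chi).
Proof.
  assert (HL : forall A B, MS4t (A <--> B) -> MS4t (A --> B)).
  { intros A B H. taut_from H. }
  assert (HR : forall A B, MS4t (A <--> B) -> MS4t (B --> A)).
  { intros A B H. taut_from H. }
  induction chi as [n| |A IHA B IHB|A IHA B IHB|A IHA B IHB|A IHA|A IHA]; cbn.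
  - ms4t_tautology.
  - ms4t_tautology.
  - taut_from IHA IHB.
  - taut_from IHA IHB.
  - assert (H : MS4t ((TNeg (flat A) || flat B) <-->
                      (TNeg (tsharp A) || tsharp B))) by taut_from IHA IHB.
    taut_from (box_mono Future _ _ (HL _ _ H)) (box_mono Future _ _ (HR _ _ H)).
  - taut_from (box_mono Future _ _ (box_mono Quant _ _ (HL _ _ IHA)))
              (box_mono Future _ _ (box_mono Quant _ _ (HR _ _ IHA))).
  - assert (H : MS4t (DiaP (TEx (tsharp A)) --> TEx (tsharp A))).
    { exact (t_trans _ _ _ (dia_mono _ _ _ (tsharp_persistent (IEx A)))
               (diaP_boxF _)). }
    pose proof (dia_mono Past _ _ (dia_mono Quant _ _ (HL _ _ IHA))) as H1.
    pose proof (t_trans _ _ _ (dia_mono Quant _ _ (HR _ _ IHA))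
                  (dia_intro Past _)) as H2.
    taut_from H H1 H2.
Qed.

(** * Theorems of MIPC translate to theorems of MS4.t *)

Lemma tsharp_imp_elim A B :
  MS4t (tsharp (IImp A B) --> tsharp A --> tsharp B).
Proof. cbn. taut_from (box_elim Future (TNeg (tsharp A) || tsharp B)). Qed.

(** The deduction rule for the translated implication; it rests on the
    persistence of the context [G]. *)
Lemma tsharp_imp_intro G A B :
  MS4t (tsharp G --> tsharp A --> tsharp B) ->
  MS4t (tsharp G --> tsharp (IImp A B)).
Proof.
  intro H. cbn.
  assert (H1 : MS4t (tsharp G --> TNeg (tsharp A) || tsharp B)) by taut_from H.
  exact (t_trans _ _ _ (tsharp_persistent G) (box_mono _ _ _ H1)).
Qed.

Lemma tsharp_imp_intro0 A B :
  MS4t (tsharp A --> tsharp B) -> MS4t (tsharp (IImp A B)).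
Proof. intro H. cbn. apply ms4t_nec. taut_from H. Qed.

Lemma tsharp_imp_intro2 G H A B :
  MS4t (tsharp G --> tsharp H --> tsharp A --> tsharp B) ->
  MS4t (tsharp G --> tsharp H --> tsharp (IImp A B)).
Proof.
  intro D.
  assert (D1 : MS4t (tsharp (IAnd G H) --> tsharp A --> tsharp B))
    by (cbn; taut_from D).
  pose proof (tsharp_imp_intro _ _ _ D1) as D2.
  cbn in *. taut_from D2.
Qed.

Lemma tsharp_iff_elim A B :
  MS4t (tsharp (IIff A B)) ->
  MS4t (tsharp A --> tsharp B) /\ MS4t (tsharp B --> tsharp A).
Proof.
  intro H. cbn in H.
  pose proof (tsharp_imp_elim A B) as H1.
  pose proof (tsharp_imp_elim B A) as H2.
  cbn in H1, H2. split; [taut_from H H1 | taut_from H H2].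
Qed.

Lemma tsharp_iff_intro A B :
  MS4t (tsharp A --> tsharp B) -> MS4t (tsharp B --> tsharp A) ->
  MS4t (tsharp (IIff A B)).
Proof.
  intros H1 H2.
  pose proof (tsharp_imp_intro0 _ _ H1) as H3.
  pose proof (tsharp_imp_intro0 _ _ H2) as H4.
  cbn in *. taut_from H3 H4.
Qed.

Lemma IPC_tsharp A : IPC A -> MS4t (tsharp A).
Proof.
  induction 1 as [A B|A B C|A B|A B|A B|A B|A B|A B C|A|A B _ IH1 _ IH2].
  - apply tsharp_imp_intro0, tsharp_imp_intro. ms4t_tautology.
  - apply tsharp_imp_intro0, tsharp_imp_intro, tsharp_imp_intro2.
    pose proof (tsharp_imp_elim A (IImp B C)) as H1.
    pose proof (tsharp_imp_elim B C) as H2.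
    pose proof (tsharp_imp_elim A B) as H3.
    cbn in *. taut_from H1 H2 H3.
  - apply tsharp_imp_intro0. ms4t_tautology.
  - apply tsharp_imp_intro0. ms4t_tautology.
  - apply tsharp_imp_intro0, tsharp_imp_intro. ms4t_tautology.
  - apply tsharp_imp_intro0. ms4t_tautology.
  - apply tsharp_imp_intro0. ms4t_tautology.
  - apply tsharp_imp_intro0, tsharp_imp_intro, tsharp_imp_intro2.
    pose proof (tsharp_imp_elim A C) as H1.
    pose proof (tsharp_imp_elim B C) as H2.
    cbn in *. taut_from H1 H2.
  - apply tsharp_imp_intro0. ms4t_tautology.
  - exact (ms4t_mp _ _ (ms4t_mp _ _ (tsharp_imp_elim A B) IH1) IH2).
Qed.

Lemma isubst_isubst s s' A :
  isubst s (isubst s' A) = isubst (fun n => isubst s (s' n)) A.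
Proof. induction A; cbn; congruence. Qed.

Lemma IPC_isubst s A : IPC A -> IPC (isubst s A).
Proof. induction 1; cbn in *; eauto using IPC. Qed.

(** All substitution instances are treated at once, so that the substitution
    rule needs no comparison of [tsharp (isubst s A)] with an instance of
    [tsharp A]. *)
Lemma MIPC_tsharp_instances A : MIPC A -> forall s, MS4t (tsharp (isubst s A)).
Proof.
  induction 1 as [A HA| | | | | | | | | |A B _ IH1 _ IH2|s' A _ IH|A _ IH
                 |A B _ IH|A B _ IH]; intro s.
  - apply IPC_tsharp, IPC_isubst, HA.
  - change (isubst s _) with
      (IIff (IAll (IAnd (s 0) (s 1))) (IAnd (IAll (s 0)) (IAll (s 1)))).
    set (A := s 0); set (B := s 1); clearbody A B; clear s.
    apply tsharp_iff_intro; cbn.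
    + assert (HA : MS4t (tsharp A && tsharp B --> tsharp A)) by ms4t_tautology.
      assert (HB : MS4t (tsharp A && tsharp B --> tsharp B)) by ms4t_tautology.
      taut_from (box_mono Future _ _ (box_mono Quant _ _ HA))
                (box_mono Future _ _ (box_mono Quant _ _ HB)).
    + assert (H : MS4t (tsharp A --> tsharp B --> tsharp A && tsharp B))
        by ms4t_tautology.
      taut_from (box_mono2 Future _ _ _ (box_mono2 Quant _ _ _ H)).
  - apply tsharp_imp_intro0.
    exact (t_trans _ _ _ (box_elim _ _) (box_elim _ _)).
  - apply tsharp_imp_intro0. cbn.
    refine (t_trans _ _ _ (box_box _ _) (box_mono _ _ _ _)).
    refine (t_trans _ _ _ (box_mono _ _ _ (box_box _ _)) (boxF_all _)).
  - change (isubst s _) with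
      (IIff (IEx (IOr (s 0) (s 1))) (IOr (IEx (s 0)) (IEx (s 1)))).
    set (A := s 0); set (B := s 1); clearbody A B; clear s.
    apply tsharp_iff_intro; cbn.
    + apply dia_or.
    + assert (HA : MS4t (tsharp A --> tsharp A || tsharp B)) by ms4t_tautology.
      assert (HB : MS4t (tsharp B --> tsharp A || tsharp B)) by ms4t_tautology.
      taut_from (dia_mono Quant _ _ HA) (dia_mono Quant _ _ HB).
  - apply tsharp_imp_intro0. apply dia_intro.
  - apply tsharp_imp_intro0. apply dia_dia.
  - apply tsharp_imp_intro0. cbn.
    set (a := tsharp (s 0)); set (b := tsharp (s 1)); clearbody a b.
    taut_from (ex_all_ex a) (box_dia_and Quant (TEx a) b).
  - apply (tsharp_iff_intro (IEx (IAll (s 0))) (IAll (s 0))); cbn.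
    + exact (t_trans _ _ _ (ex_boxF _) (box_mono _ _ _ (ex_all _))).
    + apply dia_intro.
  - apply (tsharp_iff_intro (IEx (s 0)) (IAll (IEx (s 0)))); cbn.
    + exact (t_trans _ _ _ (tsharp_persistent (IEx (s 0)))
               (box_mono _ _ _ (ex_all_ex _))).
    + exact (t_trans _ _ _ (box_elim _ _) (box_elim _ _)).
  - exact (ms4t_mp _ _ (ms4t_mp _ _ (tsharp_imp_elim _ _) (IH1 s)) (IH2 s)).
  - rewrite isubst_isubst. apply IH.
  - cbn. apply ms4t_nec, ms4t_nec, IH.
  - destruct (tsharp_iff_elim _ _ (IH s)) as [H1 H2].
    apply (tsharp_iff_intro (IAll (isubst s A)) (IAll (isubst s B))); cbn.
    + exact (box_mono _ _ _ (box_mono _ _ _ H1)).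
    + exact (box_mono _ _ _ (box_mono _ _ _ H2)).
  - destruct (tsharp_iff_elim _ _ (IH s)) as [H1 H2].
    apply (tsharp_iff_intro (IEx (isubst s A)) (IEx (isubst s B))); cbn.
    + exact (dia_mono _ _ _ H1).
    + exact (dia_mono _ _ _ H2).
Qed.

Lemma isubst_IVar A : isubst IVar A = A.
Proof. induction A; cbn; congruence. Qed.

Lemma MIPC_tsharp A : MIPC A -> MS4t (tsharp A).
Proof.
  intro H. rewrite <- (isubst_IVar A). exact (MIPC_tsharp_instances A H IVar).
Qed.

(** * Kripke semantics of MS4.t *)

(** Truth at a world of a structure with a relation [R] for the future and [E]
    for the quantifier; the past modality looks along the converse of [R]. *)
Fixpoint holds {W : Type} (R E : W -> W -> Prop) (V : nat -> W -> Prop)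
    (w : W) (A : tform) : Prop :=
  match A with
  | TVar n => V n w
  | TBot => False
  | TAnd A B => holds R E V w A /\ holds R E V w B
  | TOr A B => holds R E V w A \/ holds R E V w B
  | TImp A B => holds R E V w A -> holds R E V w B
  | TBox Future A => forall u, R w u -> holds R E V u A
  | TBox Past A => forall u, R u w -> holds R E V u A
  | TBox Quant A => forall u, E w u -> holds R E V u A
  end.

Lemma holds_tsubst {W : Type} (R E : W -> W -> Prop) V s A :
  forall w, holds R E V w (tsubst s A) <->
            holds R E (fun n u => holds R E V u (s n)) w A.
Proof.
  induction A as [n| |A IHA B IHB|A IHA B IHB|A IHA B IHB|m A IHA];
    intro w; cbn; try tauto.
  - rewrite IHA, IHB. tauto.
  - rewrite IHA, IHB. tauto.
  - rewrite IHA, IHB. tauto.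
  - destruct m; split; intros H u Hu; apply IHA, H, Hu.
Qed.

Lemma holds_tautology {W : Type} (R E : W -> W -> Prop) V w A :
  tautology A -> holds R E V w A.
Proof.
  intro H.
  set (v := fun B => if excluded_middle_informative (holds R E V w B)
                     then true else false).
  enough (HA : truth v A = true <-> holds R E V w A) by apply HA, H.
  clear H.
  assert (Hv : forall B, v B = true <-> holds R E V w B).
  { intro B. unfold v. destruct excluded_middle_informative; intuition discriminate. }
  induction A as [n| |A IHA B IHB|A IHA B IHB|A IHA B IHB|m A IHA].
  - apply Hv.
  - cbn. intuition discriminate.
  - cbn. rewrite <- IHA, <- IHB. apply Bool.andb_true_iff.
  - cbn. rewrite <- IHA, <- IHB. apply Bool.orb_true_iff.
  - cbn. rewrite <- IHA, <- IHB. apply Bool.implb_true_iff.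
  - apply Hv.
Qed.

(** The conditions are those for MS4, [ER_RE] being the one that validates
    [BoxF (TAll p) --> TAll (BoxF p)]; the tense axioms hold because the past is
    read along the converse of [R]. *)
Lemma MS4t_sound {W : Type} (R E : W -> W -> Prop)
    (R_refl : forall x, R x x) (R_trans : forall x y z, R x y -> R y z -> R x z)
    (E_refl : forall x, E x x) (E_sym : forall x y, E x y -> E y x)
    (E_trans : forall x y z, E x y -> E y z -> E x z)
    (ER_RE : forall x y z, E x y -> R y z -> exists w, R x w /\ E w z) A :
  MS4t A -> forall V w, holds R E V w A.
Proof.
  induction 1 as [A HA|m|m|m| | | | |A B _ IH1 _ IH2|s A _ IH|m A _ IH];
    intros V w.
  - apply holds_tautology, HA.
  - destruct m; cbn; auto.
  - destruct m; cbn; auto.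
  - destruct m; cbn; eauto.
  - cbn. intros H u Hu H'. exact (H' w Hu H).
  - cbn. intros H u Hu H'. exact (H' w Hu H).
  - cbn. intros H u Hu H'. exact (H' w (E_sym _ _ Hu) H).
  - cbn. intros H u Hu z Hz.
    destruct (ER_RE _ _ _ Hu Hz) as (y & Hy & Hyz). exact (H y Hy z Hyz).
  - exact (IH1 V w (IH2 V w)).
  - apply holds_tsubst, IH.
  - destruct m; cbn; auto.
Qed.

Local Close Scope tform_scope.
Local Open Scope iform_scope.

(** * Theories of MIPC *)

(** A theory is a set of formulas that contains the theorems of MIPC and is
    closed under modus ponens, that is, a filter of the Lindenbaum algebra. *)
Record theory (T : iform -> Prop) : Prop := {
  theory_thm : forall A, MIPC A -> T A;
  theory_mp : forall A B, T (A --> B) -> T A -> T B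
}.

Lemma MIPC_theory : theory MIPC.
Proof. split; [auto | exact mipc_mp]. Qed.

Section TheoryFacts.
Variables (T : iform -> Prop) (HT : theory T).

Lemma theory_ipc A : IPC A -> T A.
Proof. intro H. apply (theory_thm T HT), mipc_ipc, H. Qed.

Lemma theory_app A B : MIPC (A --> B) -> T A -> T B.
Proof. intro H. apply (theory_mp T HT), (theory_thm T HT), H. Qed.

Lemma theory_weaken A B : T B -> T (A --> B).
Proof. apply (theory_mp T HT), theory_ipc, ipc_k. Qed.

(** The theory generated by [T] and a formula [A]. *)
Lemma theory_extend A : theory (fun B => T (A --> B)).
Proof.
  split.
  - intros B H. apply theory_weaken, (theory_thm T HT), H.
  - intros B C H1 H2.
    refine (theory_mp T HT _ _ (theory_mp T HT _ _ _ H1) H2).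
    apply theory_ipc, ipc_s.
Qed.

Lemma theory_id A : T (A --> A).
Proof.
  apply (theory_mp T HT (A --> (A --> A))).
  - apply (theory_mp T HT (A --> (A --> A) --> A)); apply theory_ipc;
      [apply ipc_s | apply ipc_k].
  - apply theory_ipc, ipc_k.
Qed.

Lemma theory_ded A B :
  (forall T', theory T' -> (forall C, T C -> T' C) -> T' A -> T' B) ->
  T (A --> B).
Proof.
  intro H. apply (H (fun B => T (A --> B))).
  - apply theory_extend.
  - intros C. apply theory_weaken.
  - apply theory_id.
Qed.

Lemma theory_and A B : T (A && B) <-> T A /\ T B.
Proof.
  split.
  - intro H. split.
    + exact (theory_mp T HT _ _ (theory_ipc _ (ipc_and_l A B)) H).
    + exact (theory_mp T HT _ _ (theory_ipc _ (ipc_and_r A B)) H).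
  - intros [H1 H2]. refine (theory_mp T HT _ _ (theory_mp T HT _ _ _ H1) H2).
    apply theory_ipc, ipc_and_i.
Qed.

Lemma theory_or_l A B : T A -> T (A || B).
Proof. apply (theory_mp T HT), theory_ipc, ipc_or_l. Qed.

Lemma theory_or_r A B : T B -> T (A || B).
Proof. apply (theory_mp T HT), theory_ipc, ipc_or_r. Qed.

Lemma theory_or_imp A B C : T (A --> C) -> T (B --> C) -> T (A || B --> C).
Proof.
  intros H1 H2. refine (theory_mp T HT _ _ (theory_mp T HT _ _ _ H1) H2).
  apply theory_ipc, ipc_or_e.
Qed.

End TheoryFacts.

(** An implication is provable as soon as every theory that contains the premise
    contains the conclusion; this gives a natural-deduction style for proving
    theorems of MIPC. *)
Lemma MIPC_ded A B : (forall T, theory T -> T A -> T B) -> MIPC (A --> B).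
Proof.
  intro H.  apply (theory_ded _ MIPC_theory). intros T HT _. exact (H T HT).
Qed.

(** * Derived rules of MIPC *)

Definition isubst2 (A B : iform) (n : nat) : iform :=
  match n with 0 => A | _ => B end.

Lemma MIPC_trans B A C : MIPC (A --> B) -> MIPC (B --> C) -> MIPC (A --> C).
Proof.
  intros H1 H2. apply MIPC_ded. intros T HT H.
  exact (theory_app T HT _ _ H2 (theory_app T HT _ _ H1 H)).
Qed.

Lemma MIPC_iff A B :
  MIPC (A <--> B) <-> MIPC (A --> B) /\ MIPC (B --> A).
Proof. apply (theory_and _ MIPC_theory). Qed.

Lemma MIPC_all_elim A : MIPC (IAll A --> A).
Proof. exact (mipc_subst (isubst2 A A) _ mipc_all_t). Qed.

Lemma MIPC_ex_intro A : MIPC (A --> IEx A).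
Proof. exact (mipc_subst (isubst2 A A) _ mipc_ex_t). Qed.

Lemma MIPC_ex_ex A : MIPC (IEx (IEx A) --> IEx A).
Proof. exact (mipc_subst (isubst2 A A) _ mipc_ex_4). Qed.

Lemma MIPC_ex_and A B : MIPC (IEx A && IEx B --> IEx (IEx A && B)).
Proof. exact (mipc_subst (isubst2 A B) _ mipc_ex_and). Qed.

Lemma MIPC_ex_all A : MIPC (IEx (IAll A) --> IAll A).
Proof.
  exact (proj1 (proj1 (MIPC_iff _ _) (mipc_subst (isubst2 A A) _ mipc_ex_all))).
Qed.

Lemma MIPC_all_ex A : MIPC (IEx A --> IAll (IEx A)).
Proof.
  exact (proj1 (proj1 (MIPC_iff _ _) (mipc_subst (isubst2 A A) _ mipc_all_ex))).
Qed.

Lemma MIPC_ex_or A B : MIPC (IEx (A || B) <--> (IEx A || IEx B)).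
Proof. exact (mipc_subst (isubst2 A B) _ mipc_ex_or). Qed.

Lemma MIPC_all_and A B : MIPC (IAll (A && B) <--> (IAll A && IAll B)).
Proof. exact (mipc_subst (isubst2 A B) _ mipc_all_and). Qed.

Lemma MIPC_all_mono A B : MIPC (A --> B) -> MIPC (IAll A --> IAll B).
Proof.
  intro H.
  assert (H1 : MIPC (A <--> (A && B))).
  { apply MIPC_iff. split; apply MIPC_ded; intros T HT HA.
    - apply (theory_and T HT). split; [exact HA | exact (theory_app T HT _ _ H HA)].
    - apply (theory_and T HT) in HA. apply HA. }
  apply mipc_re_all, MIPC_iff in H1.
  apply MIPC_ded. intros T HT HA.
  apply (theory_app T HT _ _ (proj1 H1)) in HA.
  apply (theory_app T HT _ _ (proj1 (proj1 (MIPC_iff _ _) (MIPC_all_and A B)))) in HA.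
  apply (theory_and T HT) in HA. apply HA.
Qed.

Lemma MIPC_ex_mono A B : MIPC (A --> B) -> MIPC (IEx A --> IEx B).
Proof.
  intro H.
  assert (H1 : MIPC ((A || B) <--> B)).
  { apply MIPC_iff. split.
    - apply (theory_or_imp _ MIPC_theory); [exact H | apply (theory_id _ MIPC_theory)].
    - apply MIPC_ded. intros T HT. apply (theory_or_r T HT). }
  apply mipc_re_ex, MIPC_iff in H1.
  apply MIPC_ded. intros T HT HA.
  apply (theory_app T HT _ _ (proj1 H1)).
  apply (theory_app T HT _ _ (proj2 (proj1 (MIPC_iff _ _) (MIPC_ex_or A B)))).
  apply (theory_or_l T HT), HA.
Qed.

(** The static formulas are the fixed points of [IEx] (equivalently, of
    [IAll]) in the Lindenbaum algebra. *)
Definition static (C : iform) : Prop := MIPC (IEx C --> C).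

Lemma static_ex A : static (IEx A).
Proof. apply MIPC_ex_ex. Qed.

Lemma static_all A : static (IAll A).
Proof. apply MIPC_ex_all. Qed.

Lemma static_bot : static IBot.
Proof.
  apply (MIPC_trans (IEx (IAll IBot))).
  - apply MIPC_ex_mono, (mipc_ipc _ (ipc_bot _)).
  - exact (MIPC_trans _ _ _ (MIPC_ex_all _) (MIPC_all_elim _)).
Qed.

Lemma static_or C D : static C -> static D -> static (C || D).
Proof.
  intros HC HD. apply (MIPC_trans (IEx C || IEx D)).
  - exact (proj1 (proj1 (MIPC_iff _ _) (MIPC_ex_or C D))).
  - apply (theory_or_imp _ MIPC_theory); apply MIPC_ded; intros T HT H.
    + apply (theory_or_l T HT). exact (theory_app T HT _ _ HC H).
    + apply (theory_or_r T HT). exact (theory_app T HT _ _ HD H).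
Qed.

Lemma static_and C D : static C -> static D -> static (C && D).
Proof.
  intros HC HD. apply MIPC_ded. intros T HT H.
  apply (theory_and T HT). split.
  - apply (theory_app T HT _ _ HC).
    refine (theory_app T HT _ _ (MIPC_ex_mono _ _ _) H).
    exact (mipc_ipc _ (ipc_and_l C D)).
  - apply (theory_app T HT _ _ HD).
    refine (theory_app T HT _ _ (MIPC_ex_mono _ _ _) H).
    exact (mipc_ipc _ (ipc_and_r C D)).
Qed.

(** [IAll A] is the largest static formula below [A]. *)
Lemma static_all_intro C A :
  static C -> MIPC (C --> A) -> MIPC (C --> IAll A).
Proof.
  intros HC H. apply (MIPC_trans (IEx C)); [apply MIPC_ex_intro |].
  apply (MIPC_trans (IAll (IEx C))); [apply MIPC_all_ex |].
  apply MIPC_all_mono. exact (MIPC_trans _ _ _ HC H).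
Qed.

(** [IEx] is left adjoint to the inclusion of the static formulas, even in the
    presence of a static side assumption. *)
Lemma static_ex_elim A C D :
  static C -> static D -> MIPC (A --> C --> D) -> MIPC (IEx A --> C --> D).
Proof.
  intros HC HD H.
  apply MIPC_ded. intros T HT HA. apply (theory_ded T HT).
  intros T' HT' HTT' H'.
  apply (theory_app T' HT' _ _ HD).
  apply (theory_app T' HT' (IEx (IEx C && A))).
  - apply MIPC_ex_mono, MIPC_ded. intros S HS HCA.
    apply (theory_and S HS) in HCA.
    apply (theory_mp S HS C).
    + apply (theory_app S HS _ _ H), HCA.
    + apply (theory_app S HS _ _ HC), HCA.
  - apply (theory_app T' HT' _ _ (MIPC_ex_and C A)), (theory_and T' HT').
    split; [exact (theory_app T' HT' _ _ (MIPC_ex_intro C) H') | auto].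
Qed.

(** * Prime theories and separation *)

(** A prime theory is a prime filter of the Lindenbaum algebra; consistency is
    part of the definition. *)
Record prime (P : iform -> Prop) : Prop := {
  prime_theory : theory P;
  prime_bot : ~ P IBot;
  prime_or : forall A B, P (A || B) -> P A \/ P B
}.

(** An injective numbering of the formulas; [to_nat] is Cantor pairing. *)
Fixpoint code (A : iform) : nat :=
  match A with
  | IVar n => to_nat (0, n)
  | IBot => to_nat (1, 0)
  | IAnd A B => to_nat (2, to_nat (code A, code B))
  | IOr A B => to_nat (3, to_nat (code A, code B))
  | IImp A B => to_nat (4, to_nat (code A, code B))
  | IAll A => to_nat (5, code A)
  | IEx A => to_nat (6, code A)
  end.

Lemma to_nat_inj a b c d : to_nat (a, b) = to_nat (c, d) -> a = c /\ b = d.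
Proof.
  intro H. apply (f_equal of_nat) in H.
  rewrite !cancel_of_to in H. injection H. auto.
Qed.

Lemma code_inj A : forall B, code A = code B -> A = B.
Proof.
  induction A; intros [] H; cbn [code] in H;
    apply to_nat_inj in H; destruct H as [H0 H]; try discriminate H0;
    try (apply to_nat_inj in H; destruct H);
    f_equal; auto.
Qed.

Section Separation.
Variables (T D : iform -> Prop).
Hypothesis HT : theory T.
Hypothesis D_bot : D IBot.
Hypothesis D_or : forall A B, D A -> D B -> D (A || B).
Hypothesis T_D : forall A, D A -> ~ T A.

(** At stage [k] the formula with code [k], if any, is added whenever this
    keeps the theory disjoint from [D]. *)
Fixpoint chain (k : nat) (B : iform) : Prop :=
  match k with
  | 0 => T B
  | S k => chain k B \/
           exists A, code A = k /\ (forall C, D C -> ~ chain k (A --> C)) /\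
                     chain k (A --> B)
  end.

Lemma chain_theory k : theory (chain k).
Proof.
  induction k as [|k IH]; [exact HT |].
  split; cbn [chain].
  - intros A H. left. exact (theory_thm _ IH _ H).
  - intros A B [H1|(F & HF & HD & H1)] [H2|(G & HG & HD' & H2)].
    + left. exact (theory_mp _ IH _ _ H1 H2).
    + right. exists G. split; [exact HG |]. split; [exact HD' |].
      exact (theory_mp _ (theory_extend _ IH G) _ _ (theory_weaken _ IH _ _ H1) H2).
    + right. exists F. split; [exact HF |]. split; [exact HD |].
      exact (theory_mp _ (theory_extend _ IH F) _ _ H1 (theory_weaken _ IH _ _ H2)).
    + right. exists F. split; [exact HF |]. split; [exact HD |].
      assert (G = F) as -> by (apply code_inj; congruence).
      exact (theory_mp _ (theory_extend _ IH F) _ _ H1 H2).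
Qed.

Lemma chain_disjoint k : forall A, D A -> ~ chain k A.
Proof.
  induction k as [|k IH]; cbn [chain]; [exact T_D |].
  intros A HA [H|(F & _ & HF & H)].
  - exact (IH A HA H).
  - exact (HF A HA H).
Qed.

Lemma chain_mono j k A : j <= k -> chain j A -> chain k A.
Proof. induction 1; cbn [chain]; auto. Qed.

(** The union of the chain. *)
Definition chain_limit (A : iform) : Prop := exists k, chain k A.

Lemma chain_limit_theory : theory chain_limit.
Proof.
  split.
  - intros A H. exists 0. exact (theory_thm _ HT _ H).
  - intros A B [j Hj] [k Hk]. exists (max j k).
    apply (theory_mp _ (chain_theory _) A).
    + exact (chain_mono _ _ _ (Nat.le_max_l j k) Hj).
    + exact (chain_mono _ _ _ (Nat.le_max_r j k) Hk).
Qed.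

Lemma chain_limit_disjoint A : D A -> ~ chain_limit A.
Proof. intros HA [k H]. exact (chain_disjoint k A HA H). Qed.

Lemma chain_limit_maximal A :
  ~ chain_limit A -> exists C, D C /\ chain_limit (A --> C).
Proof.
  intro H. apply NNPP. intro HN. apply H.
  exists (S (code A)). right. exists A. split; [reflexivity |]. split.
  - intros C HC HAC. apply HN. exists C. split; [exact HC |].
    exists (code A). exact HAC.
  - apply (theory_id _ (chain_theory _)).
Qed.

(** The prime filter theorem: a theory disjoint from a set that contains
    falsity and is closed under disjunctions extends to a prime theory
    disjoint from that set. *)
Lemma prime_separation :
  exists P, prime P /\ (forall A, T A -> P A) /\ (forall A, D A -> ~ P A).
Proof.
  exists chain_limit. split; [split |split].
  - exact chain_limit_theory.
  - exact (chain_limit_disjoint _ D_bot).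
  - intros A B HAB. apply NNPP. intro HN. apply not_or_and in HN.
    destruct (chain_limit_maximal A (proj1 HN)) as (C & HC & HAC).
    destruct (chain_limit_maximal B (proj2 HN)) as (C' & HC' & HBC).
    apply (chain_limit_disjoint _ (D_or _ _ HC HC')).
    refine (theory_mp _ chain_limit_theory _ _ _ HAB).
    apply (theory_or_imp _ chain_limit_theory).
    + apply (theory_ded _ chain_limit_theory). intros S HS HLS HA.
      apply (theory_or_l S HS), (theory_mp S HS A); auto.
    + apply (theory_ded _ chain_limit_theory). intros S HS HLS HB.
      apply (theory_or_r S HS), (theory_mp S HS B); auto.
  - intros A HA. exists 0. exact HA.
  - exact chain_limit_disjoint.
Qed.

End Separation.

(** The special case of avoiding one formula: [D] consists of the formulas that
    provably imply it. *)
Lemma prime_avoiding T A :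
  theory T -> ~ T A -> exists P, prime P /\ (forall B, T B -> P B) /\ ~ P A.
Proof.
  intros HT HA.
  destruct (prime_separation T (fun B => MIPC (B --> A)) HT) as (P & HP & HTP & HPA).
  - exact (mipc_ipc _ (ipc_bot A)).
  - intros B C. apply (theory_or_imp _ MIPC_theory).
  - intros B HB H. exact (HA (theory_app T HT _ _ HB H)).
  - exists P. split; [exact HP |]. split; [exact HTP |].
    apply HPA, (theory_id _ MIPC_theory).
Qed.

(** Two sets of formulas are equivalent when they contain the same static
    formulas. *)
Definition static_eq (x y : iform -> Prop) : Prop :=
  forall C, static C -> x C <-> y C.

(** The hypothesis says that the static consequences of [x] lie in [z]; it is
    what keeps the theory generated by [x] and the static part of [z] from
    proving static formulas outside [z]. *)
Lemma prime_extension x z :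
  theory x -> prime z -> (forall A, x A -> z (IEx A)) ->
  exists w, prime w /\ (forall A, x A -> w A) /\ static_eq w z.
Proof.
  intros Hx Hz Hxz. pose proof (prime_theory z Hz) as Tz.
  (* The theory generated by [x] and the static part of [z] is separated from
     the static formulas outside [z]. *)
  destruct (prime_separation
              (fun B => exists C, static C /\ z C /\ x (C --> B))
              (fun C => static C /\ ~ z C)) as (w & Hw & Hin & Hout).
  - split.
    + (* [IAll (IBot --> IBot)] serves as a static theorem. *)
      intros A HA. exists (IAll (IBot --> IBot)).
      split; [apply static_all |].
      assert (H : MIPC (IAll (IBot --> IBot)))
        by (apply mipc_nec, (theory_id _ MIPC_theory)).
      split; [exact (theory_thm z Tz _ H) |].
      apply (theory_weaken x Hx), (theory_thm x Hx), HA.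
    + intros A B (C & HC & HzC & HxC) (C' & HC' & HzC' & HxC').
      exists (C && C'). split; [apply static_and; assumption |].
      split; [apply (theory_and z Tz); auto |].
      apply (theory_ded x Hx). intros S HS HxS H.
      apply (theory_and S HS) in H.
      apply (theory_mp S HS A); [apply (theory_mp S HS C) |
                                 apply (theory_mp S HS C')]; intuition.
  - exact (conj static_bot (prime_bot z Hz)).
  - intros A B [HA HzA] [HB HzB]. split; [apply static_or; assumption |].
    intro H. destruct (prime_or z Hz _ _ H); auto.
  - intros B [HB HzB] (C & HC & HzC & HxC). apply HzB.
    apply (theory_mp z Tz C); [| exact HzC].
    apply (theory_app z Tz (IEx (C --> B))); [| exact (Hxz _ HxC)].
    apply static_ex_elim; [assumption | assumption |].
    apply (theory_id _ MIPC_theory).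
  - exists w. split; [exact Hw |]. split.
    + intros A HA. apply Hin. exists (IAll (IBot --> IBot)).
      split; [apply static_all |]. split.
      * apply (theory_thm z Tz), mipc_nec, (theory_id _ MIPC_theory).
      * apply (theory_weaken x Hx), HA.
    + intros C HC. split; intro H.
      * apply NNPP. intro HN. exact (Hout C (conj HC HN) H).
      * apply Hin. exists C. split; [exact HC |]. split; [exact H |].
        apply (theory_id x Hx).
Qed.

(** * The canonical frame and the truth lemma *)

(** The worlds of the canonical structure are the prime theories. *)
Definition world : Type := {P : iform -> Prop | prime P}.

Definition mem (w : world) (A : iform) : Prop := proj1_sig w A.

(** The canonical future relation is inclusion. *)
Definition canR (x y : world) : Prop := forall A, mem x A -> mem y A.

(** The canonical quantifier relation. *)
Definition canE (x y : world) : Prop := static_eq (mem x) (mem y).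

(** The canonical valuation is already closed upwards under [canR], so that
    [BoxF (TVar n)] and [TVar n] hold at the same worlds. *)
Definition canV (n : nat) (w : world) : Prop := mem w (IVar n).

Lemma mem_prime w : prime (mem w).
Proof. exact (proj2_sig w). Qed.

Lemma mem_theory w : theory (mem w).
Proof. exact (prime_theory _ (mem_prime w)). Qed.

Lemma world_extension x (z : world) :
  theory x -> (forall A, x A -> mem z (IEx A)) ->
  exists w : world, (forall A, x A -> mem w A) /\ canE w z.
Proof.
  intros Hx Hxz.
  destruct (prime_extension x (mem z) Hx (mem_prime z) Hxz) as (w & Hw & H).
  exists (exist _ w Hw). exact H.
Qed.

(** A theory is the intersection of the prime theories containing it. *)
Lemma world_avoiding T A :
  theory T -> ~ T A -> exists w : world, (forall B, T B -> mem w B) /\ ~ mem w A.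
Proof.
  intros HT HA. destruct (prime_avoiding T A HT HA) as (w & Hw & H).
  exists (exist _ w Hw). exact H.
Qed.

Lemma canE_sym x y : canE x y -> canE y x.
Proof. intros H C HC. symmetry. exact (H C HC). Qed.

Lemma mem_ex_intro w A : mem w A -> mem w (IEx A).
Proof. exact (theory_app _ (mem_theory w) _ _ (MIPC_ex_intro A)). Qed.

Lemma canE_canR x y z :
  canE x y -> canR y z -> exists w, canR x w /\ canE w z.
Proof.
  intros Hxy Hyz. apply (world_extension (mem x) z (mem_theory x)).
  intros A HA. apply Hyz, (Hxy _ (static_ex A)), mem_ex_intro, HA.
Qed.

Lemma mem_imp x A B :
  mem x (A --> B) <-> forall y, canR x y -> ~ mem y A \/ mem y B.
Proof.
  split.
  - intros H y Hy. destruct (classic (mem y A)) as [HA|HA]; [right | left; exact HA].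
    exact (theory_mp _ (mem_theory y) _ _ (Hy _ H) HA).
  - intro H. apply NNPP. intro HN.
    destruct (world_avoiding _ B (theory_extend _ (mem_theory x) A) HN)
      as (y & Hy & HB).
    destruct (H y) as [HA|HB'].
    + intros C HC. apply Hy, (theory_weaken _ (mem_theory x)), HC.
    + apply HA, Hy, (theory_id _ (mem_theory x)).
    + exact (HB HB').
Qed.

Lemma mem_ex x A : mem x (IEx A) <-> exists y, canE x y /\ mem y A.
Proof.
  split.
  - intro H.
    destruct (world_extension (fun B => MIPC (A --> B)) x) as (y & Hy & Hyx).
    + exact (theory_extend _ MIPC_theory A).
    + intros B HB. exact (theory_app _ (mem_theory x) _ _ (MIPC_ex_mono _ _ HB) H).
    + exists y. split; [exact (canE_sym _ _ Hyx) |].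
      apply Hy, (theory_id _ MIPC_theory).
  - intros (y & Hxy & HA). apply (Hxy _ (static_ex A)), mem_ex_intro, HA.
Qed.

Lemma mem_all x A :
  mem x (IAll A) <-> forall y, canR x y -> forall z, canE y z -> mem z A.
Proof.
  split.
  - intros H y Hy z Hz.
    apply (theory_app _ (mem_theory z) _ _ (MIPC_all_elim A)).
    apply (Hz _ (static_all A)), Hy, H.
  - intro H. apply NNPP. intro HN.
    (* First [z] is chosen above the static part of [x] and avoiding [A]; then
       [y] above [x] and equivalent to [z]. *)
    destruct (world_avoiding
                (fun B => exists C, static C /\ mem x C /\ MIPC (C --> B)) A)
      as (z & Hz & HA).
    + split.
      * intros B HB. exists (IAll B). split; [apply static_all |].
        split; [apply (theory_thm _ (mem_theory x)), mipc_nec, HB |].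
        apply MIPC_all_elim.
      * intros B C (F & HF & HxF & HFB) (G & HG & HxG & HGB).
        exists (F && G). split; [apply static_and; assumption |].
        split; [apply (theory_and _ (mem_theory x)); auto |].
        apply MIPC_ded. intros S HS HFG. apply (theory_and S HS) in HFG.
        apply (theory_mp S HS B).
        -- apply (theory_app S HS _ _ HFB), HFG.
        -- apply (theory_app S HS _ _ HGB), HFG.
    + intros (C & HC & HxC & HCA). apply HN.
      exact (theory_app _ (mem_theory x) _ _ (static_all_intro C A HC HCA) HxC).
    + destruct (world_extension (mem x) z (mem_theory x)) as (y & Hxy & Hyz).
      * intros B HB. apply Hz. exists (IEx B).
        split; [apply static_ex |]. split; [exact (mem_ex_intro _ _ HB) |].
        apply (theory_id _ MIPC_theory).
      * exact (HA (H y Hxy z Hyz)).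
Qed.

(** The truth lemma. *)
Lemma holds_tsharp A : forall x, holds canR canE canV x (tsharp A) <-> mem x A.
Proof.
  induction A as [n| |A IHA B IHB|A IHA B IHB|A IHA B IHB|A IHA|A IHA]; intro x.
  - cbn. split.
    + intro H. apply H. intros A HA. exact HA.
    + intros H y Hy. apply Hy, H.
  - split; [intros [] | apply (prime_bot _ (mem_prime x))].
  - cbn. rewrite IHA, IHB. symmetry. apply (theory_and _ (mem_theory x)).
  - cbn. rewrite IHA, IHB. split.
    + intros [H|H];
        [apply (theory_or_l _ (mem_theory x)) | apply (theory_or_r _ (mem_theory x))];
        exact H.
    + apply (prime_or _ (mem_prime x)).
  - rewrite mem_imp. cbn.
    split; intros H y Hy; specialize (H y Hy);
      rewrite (IHA y), (IHB y) in *; exact H.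
  - rewrite mem_all. cbn.
    split; intros H y Hy z Hz; apply IHA, (H y Hy z Hz).
  - rewrite mem_ex. cbn. split.
    + intro H. apply NNPP. intro HN. apply H. intros y Hy HA.
      apply HN. exists y. split; [exact Hy | apply IHA, HA].
    + intros (y & Hy & HA) H. apply (H y Hy), IHA, HA.
Qed.

Lemma tsharp_MIPC A : MS4t (tsharp A) -> MIPC A.
Proof.
  intro H. apply NNPP. intro HN.
  destruct (world_avoiding MIPC A MIPC_theory HN) as (w & _ & Hw).
  apply Hw, holds_tsharp.
  refine (MS4t_sound canR canE _ _ _ _ _ _ _ H canV w).
  - intros x A' HA. exact HA.
  - intros x y z Hxy Hyz A' HA. apply Hyz, Hxy, HA.
  - intros x C HC. reflexivity.
  - exact canE_sym.
  - intros x y z Hxy Hyz C HC. rewrite (Hxy C HC). exact (Hyz C HC).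
  - exact canE_canR.
Qed.

Local Close Scope iform_scope.

Theorem theorem4p21 :
  (forall chi : iform, MS4t (flat chi <--> tsharp chi))
  /\ (forall chi : iform, MIPC chi <-> MS4t (flat chi)).
Proof.
  split.
  - exact flat_tsharp_iff.
  - intro chi. pose proof (flat_tsharp_iff chi) as Hiff.
    split; intro H.
    + taut_from Hiff (MIPC_tsharp chi H).
    + apply tsharp_MIPC. taut_from Hiff H.
Qed.
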